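(* Let $h:[-1,1]\to\mathbb{R}$ be continuous on $[-1,1]$ (in particular finite at $1$), twelve times differentiable on $(-1,1)$ with $h^{(12)}(t)\ge0$ for $t\in(-1,1)$. Let $T_1=(-\frac13,-\frac16)\cup(\frac16,\frac13)$. Then for every $T_1$-avoiding spherical $11$-design $C\subset\mathbb{S}^{47}$ with $|C|=52\,416\,000$, \[ \mathcal{E}^h(C)\le \mathcal{E}^h(C^* ), \] where $C^*$ is any of the four codes formed by the minimal vectors (normalized to unit length) of the even unimodular extremal lattices $P_{48p},P_{48q},P_{48m},P_{48n}$ in $\mathbb{R}^{48}$; i.e. these four codes are universally optimal with respect to maximal $h$-energy in this class.
   Context: $\mathbb{S}^{47}$ is the unit sphere in $\mathbb{R}^{48}$. A spherical code is a finite set $C\subset\mathbb{S}^{47}$ with $|C|\ge2$; $I(C)=\{x\cdot y:x,y\in C,x\ne y\}$; $C$ is $T$-avoiding if $I(C)\cap T=\emptyset$. The $h$-energy is $\mathcal{E}^h(C)=\frac1{|C|}\sum_{x,y\in C,x\ne y}h(x\cdot y)$. A spherical $11$-design is a code $C$ with $\int_{\mathbb{S}^{47}}p\,d\sigma=\frac1{|C|}\sum_{x\in C}p(x)$ for all polynomials $p$ of total degree at most $11$, $\sigma$ the normalized surface measure. $P_{48p},P_{48q},P_{48m}$ are the extremal even unimodular lattices in dimension 48 described by Conway–Sloane, and $P_{48n}$ is the fourth one found by Nebe; each has $52\,416\,000$ minimal vectors, and the normalized minimal vectors form a $T_1$-avoiding spherical $11$-design whose $h$-energy equals $36848(h(-\frac12)+h(\frac12))+1678887(h(-\frac13)+h(\frac13))+12608784(h(-\frac16)+h(\frac16))+23766960h(0)+h(-1)$.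 *)

(* Defs.v *)
From HB Require Import structures.
From mathcomp Require Import all_boot all_order all_algebra.
From mathcomp Require Import mpoly.
From mathcomp Require Import all_classical all_reals all_analysis.

Set Implicit Arguments.
Unset Strict Implicit.
Unset Printing Implicit Defensive.

Import Order.TTheory GRing.Theory Num.Theory.
Local Open Scope ring_scope.

Section Defs.
Variable R : realType.

Definition dotp n (x y : 'rV[R]_n) : R := \sum_(i < n) x 0 i * y 0 i.
Definition enorm n (x : 'rV[R]_n) : R := Num.sqrt (dotp x x).

Definition on_sphere n (x : 'rV[R]_n) : Prop := dotp x x = 1.

Definition spherical_code n (C : seq 'rV[R]_n) : Prop :=
  [/\ uniq C, (2 <= size C)%N & forall x, x \in C -> on_sphere x].

Definition avoiding n (T : set R) (C : seq 'rV[R]_n) : Prop :=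
  forall x y, x \in C -> y \in C -> x != y -> ~ T (dotp x y).

Definition energy n (h : R -> R) (C : seq 'rV[R]_n) : R :=
  (size C)%:R^-1 * \sum_(x <- C) \sum_(y <- C | y != x) h (dotp x y).

(* Lebesgue integral over R^n, computed as an iterated one-dimensional
   Lebesgue integral (Fubini); points of R^n are lists of coordinates. *)
Fixpoint iter_integral (k : nat) (f : seq R -> R) : \bar R :=
  match k with
  | 0%N => (f [::])%:E
  | k'.+1 => (\int[@lebesgue_measure R]_(t in [set: R])
                 iter_integral k' (fun s => f (t :: s)))%E
  end.

Definition row_of_seq n (s : seq R) : 'rV[R]_n := \row_(i < n) nth 0 s i.

(* Integral against the normalized surface measure sigma on S^{n-1}, via the
   cone (radial projection) description of sigma:
     int_S f dsigma = (1/vol(B^n)) int_{B^n} f(x/|x|) dx. *)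
Definition sphere_integral n (f : 'rV[R]_n -> R) : R :=
  fine (iter_integral n (fun s => let x := row_of_seq n s in
          if enorm x <= 1 then f ((enorm x)^-1 *: x) else 0))
  / fine (iter_integral n (fun s => if enorm (row_of_seq n s) <= 1 then 1 else 0)).

Definition peval n (p : mpoly.mpoly n R) (x : 'rV[R]_n) : R :=
  mpoly.meval (fun i => x 0 i) p.

Definition spherical_design n (t : nat) (C : seq 'rV[R]_n) : Prop :=
  spherical_code C /\
  forall p : mpoly.mpoly n R, (msize p <= t.+1)%N ->
    sphere_integral (peval p) = (size C)%:R^-1 * \sum_(x <- C) peval p x.

Definition T1 : set R :=
  [set t | (- (1/3) < t < - (1/6)) \/ (1/6 < t < 1/3)].

(* The h-energy of the (normalized) minimal-vector codes of P48p, P48q, P48m, P48n,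
   as given by their (common) distance distribution. *)
Definition energy_P48 (h : R -> R) : R :=
  36848%:R * (h (- (1/2)) + h (1/2)) + 1678887%:R * (h (- (1/3)) + h (1/3))
  + 12608784%:R * (h (- (1/6)) + h (1/6)) + 23766960%:R * h 0 + h (-1).

End Defs.

(* Main.v *)
Require Import Defs.
From HB Require Import structures.
From mathcomp Require Import all_boot all_order all_algebra.
From mathcomp Require Import all_classical all_reals all_analysis.
From mathcomp Require Import measurable_realfun.
From mathcomp Require Import -(notations) mpoly.
From mathcomp Require Import ring lra.

(** The design property turns an inequality h <= g on the admissible inner
    products, with g a polynomial of degree at most 11, into
    energy h C <= |C| m(g) - g(1), where m(g) is the mean of g(x . y) over
    the sphere.  Take for g the Hermite interpolant of h at -1, -1/3, -1/6, 1/6,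
    1/3, 1 (simply) and -1/2, 0, 1/2 (doubly): the nodal polynomial of degree 12
    is nonpositive on [-1, 1] outside T1, so h <= g there since h^(12) >= 0.
    The nodes other than 1 are the inner products of the minimal vectors of
    P48, and with their weights they give a quadrature rule for m.

    The moments of x . y follow from the rotation invariance of the iterated
    Lebesgue integral alone: for an 11-design the spherical integral agrees
    with an average over C, hence is linear and sees only |y| = 1, so that no
    integral ever has to be computed. *)

Set Implicit Arguments.
Unset Strict Implicit.
Unset Printing Implicit Defensive.

Import Order.TTheory GRing.Theory Num.Def Num.Theory numFieldTopology.Exports numFieldNormedType.Exports.
Local Open Scope ring_scope.
Local Open Scope classical_set_scope.

(** * Rotation invariance of plane Lebesgue integrals *)

Section PlaneRotation.
Context {R : realType}.
Local Notation mu := (@lebesgue_measure R).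
Local Open Scope ereal_scope.

(** Translation preserves the length of half-open intervals, and these lengths determine Lebesgue
    measure; the rest is a change of variables along the pushforward. *)
Lemma ge0_integral_lebesgue_shift (f : R -> \bar R) (c : R) :
  measurable_fun setT f -> (forall t, 0 <= f t) ->
  \int[mu]_t f (t + c)%R = \int[mu]_t f t.
Proof.
move=> mf f0.
pose phi : R -> measurableTypeR R := fun t => (t + c)%R.
have mphi : measurable_fun setT phi by exact: measurable_funD.
have phiE (A : set R) : measurable A -> pushforward mu phi A = mu A.
  move=> mA; apply/esym/lebesgue_measure_unique => //= _ [[a b]] _ <-.
  rewrite /pushforward.
  have -> : phi @^-1` `]a, b]%classic = `](a - c)%R, (b - c)%R]%classic.
    by apply/seteqP; split=> x /=; rewrite !in_itv /= /phi ltrBlDr lerBrDr.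
  rewrite !lebesgue_measure_itv /= !lte_fin ltrD2r; case: ifP => // _.
  by congr (_%:E); ring.
transitivity (\int[pushforward mu phi]_t f t); last first.
  by apply: eq_measure_integral => A mA _; exact: phiE.
by rewrite ge0_integral_pushforward.
Qed.

Lemma ge0_integral_vshear (F : R * R -> \bar R) (a : R) :
  measurable_fun setT F -> (forall z, 0 <= F z) ->
  \int[mu]_s \int[mu]_t F (s, t + a * s)%R = \int[mu]_s \int[mu]_t F (s, t).
Proof.
move=> mF F0; apply: eq_integral => s _.
apply: (@ge0_integral_lebesgue_shift (fun t => F (s, t))) => //.
exact: measurableT_comp.
Qed.

(** Tonelli makes the sheared variable the inner one, where the shear is a mere translation. *)
Lemma ge0_integral_hshear (F : R * R -> \bar R) (a : R) :
  measurable_fun setT F -> (forall z, 0 <= F z) ->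
  \int[mu]_s \int[mu]_t F (s + a * t, t)%R = \int[mu]_s \int[mu]_t F (s, t).
Proof.
move=> mF F0.
have mH : measurable_fun setT (fun z : R * R => F (z.1 + a * z.2, z.2)%R).
  apply: measurableT_comp => //; apply: measurable_fun_pair => //.
  by apply: measurable_funD => //; exact: measurable_funM.
transitivity (\int[mu]_t \int[mu]_s F (s + a * t, t)%R).
  exact: (@fubini_tonelli _ _ _ _ _ lebesgue_measure lebesgue_measure _ mH
            (fun z => F0 _)).
transitivity (\int[mu]_t \int[mu]_s F (s, t)); last first.
  by apply/esym; exact:
    (@fubini_tonelli _ _ _ _ _ lebesgue_measure lebesgue_measure _ mF F0).
apply: eq_integral => t _.
apply: (@ge0_integral_lebesgue_shift (fun s => F (s, t))) => //.
exact: measurableT_comp.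
Qed.

(* A rotation which is not a half-turn or the identity is a product of three
   shears. *)
Lemma ge0_integral_rotation (F : R * R -> \bar R) (a b : R) :
  (a ^+ 2 + b ^+ 2 = 1)%R ->
  measurable_fun setT F -> (forall z, 0 <= F z) ->
  \int[mu]_s \int[mu]_t F (a * s - b * t, b * s + a * t)%R =
  \int[mu]_s \int[mu]_t F (s, t).
Proof.
wlog b0 : F a b / b != 0%R => [wlg|] ab1 mF F0.
  have [b0|b0] := eqVneq b 0%R; last exact: (wlg F a b).
  have : (a == 1)%R || (a == -1)%R.
    by rewrite -eqf_sqr expr1n -ab1 b0 expr0n addr0.
  have mrot : measurable_fun setT
      (fun z : R * R => F (0 * z.1 - 1 * z.2, 1 * z.1 + 0 * z.2)%R).
    apply: measurableT_comp => //; apply: measurable_fun_pair.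
      by apply: measurable_funB => //; exact: measurable_funM.
    by apply: measurable_funD => //; exact: measurable_funM.
  case/orP => /eqP ->.
    apply: eq_integral => s _; apply: eq_integral => t _.
    by rewrite b0 !mul0r !mul1r subr0 add0r.
  (* The half-turn is the square of the quarter-turn, for which [b = 1]. *)
  have q1 : (0 ^+ 2 + 1 ^+ 2 = 1 :> R)%R by rewrite expr0n add0r expr1n.
  apply: etrans (wlg F 0%R 1%R (oner_neq0 _) q1 mF F0).
  apply: etrans (wlg _ 0%R 1%R (oner_neq0 _) q1 mrot (fun=> F0 _)).
  apply: eq_integral => s _; apply: eq_integral => t _.
  by rewrite b0 /=; congr (F (_, _)); ring.
(* For [a = cos u] and [b = sin u], [l] is [- tan (u/2)], and the rotation factors as
   [S \o T \o S]. *)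
pose l := ((a - 1) / b)%R.
pose S (z : R * R) := (z.1 + l * z.2, z.2)%R.
pose T (z : R * R) := (z.1, z.2 + b * z.1)%R.
have mS : measurable_fun setT S.
  apply: measurable_fun_pair => //.
  by apply: measurable_funD => //; exact: measurable_funM.
have mT : measurable_fun setT T.
  apply: measurable_fun_pair => //.
  by apply: measurable_funD => //; exact: measurable_funM.
have mFS : measurable_fun setT (F \o S) by exact: measurableT_comp.
have mFST : measurable_fun setT (F \o S \o T) by exact: measurableT_comp.
apply: etrans (ge0_integral_hshear l mF F0).
apply: etrans (ge0_integral_vshear b mFS (fun=> F0 _)).
apply: etrans (ge0_integral_hshear l mFST (fun=> F0 _)).
apply: eq_integral => s _; apply: eq_integral => t _.
have lb : (l * b = a - 1)%R by rewrite divfK.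
have e : (1 + l * b = a)%R by rewrite lb addrC subrK.
have e' : (l + l * a = - b)%R.
  apply: (mulIf b0).
  have -> : ((l + l * a) * b = l * b * (1 + a))%R by ring.
  have -> : (- b * b = a ^+ 2 - (a ^+ 2 + b ^+ 2))%R by ring.
  by rewrite lb ab1; ring.
rewrite /S /T /=.
have -> : (s + l * t + l * (t + b * (s + l * t)) =
  (1 + l * b) * s + (l + l * (1 + l * b)) * t)%R by ring.
have -> : (t + b * (s + l * t) = b * s + (1 + l * b) * t)%R by ring.
by rewrite e e' mulNr.
Qed.

End PlaneRotation.

(** * Rotation invariance of the iterated integral *)

Section IteratedIntegral.
Context {R : realType}.

(* The parameter absorbs the outer coordinates one by one, so that no product
   of [k] copies of R is needed to express measurability in all variables. *)
Fixpoint jointly_measurable (k : nat) {d : measure_display}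
    {T : measurableType d} (f : T -> seq R -> R) : Prop :=
  match k with
  | 0%N => measurable_fun setT (fun x => f x [::])
  | k'.+1 => jointly_measurable k'
      (fun (z : T * R) (s : seq R) => f z.1 (z.2 :: s))
  end.

Lemma eq_iter_integral (k : nat) (f g : seq R -> R) :
  (forall s, size s = k -> f s = g s) -> iter_integral k f = iter_integral k g.
Proof.
elim: k f g => [|k IH] f g fg /=; first by rewrite fg.
by apply: eq_integral => t _; apply: IH => s sk; apply: fg; rewrite /= sk.
Qed.

Lemma iter_integral_ge0 (k : nat) (f : seq R -> R) :
  (forall s, 0 <= f s) -> (0 <= iter_integral k f)%E.
Proof.
elim: k f => [|k IH] f f0 /=; first by rewrite lee_fin.
by apply: integral_ge0 => t _; exact: IH.
Qed.

Lemma measurable_iter_integral (k : nat) (d : measure_display)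
    (T : measurableType d) (f : T -> seq R -> R) :
  jointly_measurable k f -> (forall x s, 0 <= f x s) ->
  measurable_fun setT (fun x => iter_integral k (f x)).
Proof.
elim: k d T f => [|k IH] d T f /= mf f0; first exact/measurable_EFinP.
have mz := IH _ _ _ mf (fun z s => f0 _ _).
apply: (@measurable_fun_fubini_tonelli_F _ _ _ _ _ lebesgue_measure _ mz).
by move=> z; exact: iter_integral_ge0.
Qed.

(** Adjacent coordinates are rotated because they are consecutive integration variables; these
    rotations already act transitively on the unit sphere in dimension at least 2. *)
Fixpoint givens (i : nat) (a b : R) (s : seq R) : seq R :=
  match i, s with
  | 0%N, x :: y :: u => a * x - b * y :: b * x + a * y :: u
  | i'.+1, x :: u => x :: givens i' a b u
  | _, _ => s
  end.

(** The outer [i] coordinates are absorbed into the parameter; the two integrals that are then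
    outermost form a plane integral. *)
Lemma iter_integral_givens (n i : nat) (a b : R) (d : measure_display)
    (T : measurableType d) (f : T -> seq R -> R) (x : T) :
  (i.+1 < n)%N -> a ^+ 2 + b ^+ 2 = 1 ->
  jointly_measurable n f -> (forall x s, 0 <= f x s) ->
  iter_integral n (fun s => f x (givens i a b s)) = iter_integral n (f x).
Proof.
move=> + ab1; elim: i n d T f x => [|i IH] [|n] d T f x //= iltn mf f0;
  last first.
  apply: eq_integral => t _.
  exact: (IH _ _ _ (fun (z : T * R) s => f z.1 (z.2 :: s)) (x, t)).
case: n iltn mf => [//|n] _ mf.
pose F (z : R * R) := iter_integral n (fun s => f x (z.1 :: z.2 :: s)).
have mF : measurable_fun setT F.
  have mG := measurable_iter_integral (k := n) mf (fun z s => f0 _ _).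
  have mp : measurable_fun setT (fun z : R * R => ((x, z.1), z.2)).
    by apply: measurable_fun_pair => //; exact: measurable_fun_pair.
  exact: (measurableT_comp mG mp).
apply: (ge0_integral_rotation ab1 mF) => z.
exact: iter_integral_ge0.
Qed.

End IteratedIntegral.

(** * Transitivity of the rotations and zonal integrals *)

Section Zonal.
Context {R : realType}.

Fixpoint dot (u v : seq R) : R :=
  match u, v with
  | x :: u', y :: v' => x * y + dot u' v'
  | _, _ => 0
  end.

Lemma dotE (u v : seq R) :
  dot u v = \sum_(i < size u) nth 0 u i * nth 0 v i.
Proof.
elim: u v => [|x u IH] [|y v] /=; rewrite ?big_ord0 ?big_ord_recl //=.
  by rewrite mulr0 add0r big1// => i _; rewrite ?nth_nil mulr0.
by rewrite IH.
Qed.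

Lemma dot_givens (i : nat) (a b : R) (u v : seq R) :
  a ^+ 2 + b ^+ 2 = 1 -> size u = size v ->
  dot (givens i a b u) (givens i a b v) = dot u v.
Proof.
move=> ab1; elim: i u v => [|i IH] [|x u] [|y v] //= [uv]; last by rewrite IH.
case: u v uv => [|x' u] [|y' v] //= _.
rewrite !addrA; congr (_ + _).
transitivity ((a ^+ 2 + b ^+ 2) * (x * y + x' * y')); first by ring.
by rewrite ab1 mul1r.
Qed.

(** Working up from the last coordinate, each rotation moves the length of the tail into the entry
    before it. The sign of [r] is left open. *)
Lemma givens_normal_form (T : Type) (n : nat) (P : seq R -> T) :
  (forall i a b u, size u = n.+1 -> (i < n)%N -> a ^+ 2 + b ^+ 2 = 1 ->
     P (givens i a b u) = P u) ->
  forall u, size u = n.+1 ->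
  exists2 r, r ^+ 2 = dot u u & P u = P (r :: nseq n 0).
Proof.
elim: n P => [|n IH] P Pgivens [//|x u] [un].
  by case: u un => // _; exists x; rewrite //= addr0 expr2.
have [i a b v vn ilt ab|r r2 Pr] := IH (fun v => P (x :: v)) _ u un.
  by rewrite -(Pgivens i.+1 a b (x :: v))//= vn.
rewrite Pr /= -r2 -expr2.
have [s0|s0] := eqVneq (x ^+ 2 + r ^+ 2) 0.
  have /andP[/eqP x0 /eqP r0] : (x ^+ 2 == 0) && (r ^+ 2 == 0).
    by rewrite -paddr_eq0 ?sqr_ge0// s0.
  exists 0; first by rewrite s0 expr0n.
  by move/eqP: x0; move/eqP: r0; rewrite !sqrf_eq0 => /eqP-> /eqP->.
pose p := Num.sqrt (x ^+ 2 + r ^+ 2).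
have p2 : p ^+ 2 = x ^+ 2 + r ^+ 2 by rewrite sqr_sqrtr// addr_ge0 ?sqr_ge0.
have p0 : p != 0 by rewrite -sqrf_eq0 p2.
exists p => //.
(* This rotation sends [(x, r)] to [(p, 0)]; dividing by [p] is why the zero vector is a separate
   case. *)
rewrite -(Pgivens 0%N (x / p) (- r / p) [:: x, r & nseq n 0])//=; last 2 first.
- by rewrite size_nseq.
- by rewrite !expr_div_n sqrrN -mulrDl -p2 divff// sqrf_eq0.
congr (P [:: _, _ & _]).
  have -> : x / p * x - - r / p * r = (x ^+ 2 + r ^+ 2) / p by field.
  by rewrite -p2 expr2 mulfK.
by field.
Qed.

Lemma givens_transitive (T : Type) (n : nat) (P : seq R -> T) :
  (forall i a b u, size u = n.+2 -> (i < n.+1)%N -> a ^+ 2 + b ^+ 2 = 1 ->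
     P (givens i a b u) = P u) ->
  forall u v, size u = n.+2 -> size v = n.+2 -> dot u u = 1 -> dot v v = 1 ->
  P u = P v.
Proof.
move=> Pgivens.
(* A half-turn of the first coordinate plane joins the two signs left open by the normal form. *)
have P1 : P (-1 :: nseq n.+1 0) = P (1 :: nseq n.+1 0).
  have ab : (-1) ^+ 2 + 0 ^+ 2 = 1 :> R by rewrite sqrrN expr0n addr0 expr1n.
  have := Pgivens 0%N (-1) 0 (1 :: nseq n.+1 0) _ isT ab.
  rewrite /= size_nseq => /(_ erefl) <-.
  by rewrite !mul0r !mulr0 subr0 addr0 mulr1.
have e1 w : size w = n.+2 -> dot w w = 1 -> P w = P (1 :: nseq n.+1 0).
  move=> wn w1; have [r /eqP] := givens_normal_form Pgivens wn.
  by rewrite w1 sqrf_eq1 => /orP[]/eqP -> ->.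
by move=> u v un vn u1 v1; rewrite !e1.
Qed.

(** [A] and [B] accumulate the contributions of the coordinates already absorbed into the parameter,
    which makes the statement stable under induction. *)
Lemma jointly_measurable_dot (k : nat) (d : measure_display)
    (T : measurableType d) (u : seq R) (F : R * R -> R) (A B : T -> R) :
  measurable_fun setT F -> measurable_fun setT A -> measurable_fun setT B ->
  jointly_measurable k (fun x s => F (A x + dot u s, B x + dot s s)).
Proof.
move=> mF; elim: k d T u A B => [|k IH] d T u A B mA mB /=.
  apply: measurableT_comp => //; apply: measurable_fun_pair.
    exact: measurable_funD.
  exact: measurable_funD.
have mB' : measurable_fun setT (fun z : T * R => B z.1 + z.2 * z.2).
  apply: measurable_funD; first exact: measurableT_comp.
  exact: measurable_funM.
case: u => [|x u].
  rewrite (_ : (fun _ _ => _) = fun (z : T * R) s =>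
    F (A z.1 + dot [::] s, (B z.1 + z.2 * z.2) + dot s s)).
    by apply: IH => //; exact: measurableT_comp.
  by apply/funext => z; apply/funext => s; rewrite addrA.
rewrite (_ : (fun _ _ => _) = fun (z : T * R) s =>
  F ((A z.1 + x * z.2) + dot u s, (B z.1 + z.2 * z.2) + dot s s)).
  apply: IH => //; apply: measurable_funD; first exact: measurableT_comp.
  exact: measurable_funM.
by apply/funext => z; apply/funext => s; rewrite !addrA.
Qed.

(** Rotating [w] and [s] together changes neither inner product, and rotating [s] alone preserves
    the integral; so rotating [w] alone does too. *)
Lemma iter_integral_zonal (n : nat) (F : R * R -> R) (u v : seq R) :
  measurable_fun setT F -> (forall z, 0 <= F z) ->
  size u = n.+2 -> size v = n.+2 -> dot u u = 1 -> dot v v = 1 ->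
  iter_integral n.+2 (fun s => F (dot u s, dot s s)) =
  iter_integral n.+2 (fun s => F (dot v s, dot s s)).
Proof.
move=> mF F0.
pose P (w : seq R) := iter_integral n.+2 (fun s => F (dot w s, dot s s)).
have Pgivens i a b w : size w = n.+2 -> (i < n.+1)%N -> a ^+ 2 + b ^+ 2 = 1 ->
    P (givens i a b w) = P w.
  move=> wn ilt ab.
  have m0 : measurable_fun [set: R] (cst 0 : R -> R) by exact: measurable_cst.
  have mJ : jointly_measurable n.+2
      (fun (_ : R) s => F (dot (givens i a b w) s, dot s s)).
    have := jointly_measurable_dot n.+2 (givens i a b w) mF m0 m0.
    congr jointly_measurable; apply/funext => z; apply/funext => s.
    by rewrite !add0r.
  rewrite /P.
  transitivity (iter_integral n.+2 (fun s =>
      F (dot (givens i a b w) (givens i a b s),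
         dot (givens i a b s) (givens i a b s)))).
    exact: (esym (@iter_integral_givens _ n.+2 i _ _ _ _ _ (0 : R) ilt ab mJ
      (fun _ _ => F0 _))).
  apply: eq_iter_integral => s sn.
  by rewrite !dot_givens// wn.
exact: (givens_transitive Pgivens).
Qed.

End Zonal.

(** * Spherical integrals and zonal moments of designs *)

Section SphericalMoments.
Context {R : realType}.

Lemma dotpC (n : nat) (x y : 'rV[R]_n) : dotp x y = dotp y x.
Proof. by apply: eq_bigr => i _; rewrite mulrC. Qed.

Lemma dotpDl (n : nat) (x y z : 'rV[R]_n) :
  dotp (x + y) z = dotp x z + dotp y z.
Proof. by rewrite -big_split; apply: eq_bigr => i _; rewrite mxE mulrDl. Qed.

Lemma dotpZl (n : nat) (c : R) (x y : 'rV[R]_n) :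
  dotp (c *: x) y = c * dotp x y.
Proof. by rewrite mulr_sumr; apply: eq_bigr => i _; rewrite mxE mulrA. Qed.

Lemma dotp_ge0 (n : nat) (x : 'rV[R]_n) : 0 <= dotp x x.
Proof. by apply: sumr_ge0 => i _; rewrite -expr2 sqr_ge0. Qed.

(** The squared norms of [x + y] and [x - y] are nonnegative, which bounds [2 * dotp x y] on both
    sides. *)
Lemma ler_norm_dotp (n : nat) (x y : 'rV[R]_n) :
  dotp x x <= 1 -> dotp y y <= 1 -> `|dotp x y| <= 1.
Proof.
move=> x1 y1; rewrite ler_norml.
have := dotp_ge0 (x + y); have := dotp_ge0 (x + (-1) *: y).
rewrite !(dotpDl, dotpZl, dotpC _ (_ + _), dotpC _ (_ *: _)) (dotpC y x).
by move: (dotp x y) => t; lra.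
Qed.

(** Equality fails only at [x = 0], which the convention [0^-1 = 0] sends to the zero vector. *)
Lemma dotp_normalize (n : nat) (x : 'rV[R]_n) :
  dotp ((enorm x)^-1 *: x) ((enorm x)^-1 *: x) <= 1.
Proof.
rewrite dotpZl dotpC dotpZl mulrA -expr2 exprVn sqr_sqrtr ?dotp_ge0//.
have [->|x0] := eqVneq (dotp x x) 0; first by rewrite mulr0.
by rewrite mulVf.
Qed.

Lemma nth_codom_ord (n : nat) (f : 'I_n -> R) (i : 'I_n) :
  nth 0 (codom f) i = f i.
Proof.
by rewrite /codom /image_mem (nth_map i) ?size_enum_ord// nth_ord_enum.
Qed.

Lemma dot_codom (n : nat) (x : 'rV[R]_n) (s : seq R) :
  dot (codom (x 0)) s = dotp x (row_of_seq n s).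
Proof.
rewrite dotE /dotp size_codom card_ord; apply: eq_bigr => i _.
by rewrite mxE nth_codom_ord.
Qed.

Lemma dot_row_of_seq (n : nat) (s : seq R) : size s = n ->
  dot s s = dotp (row_of_seq n s) (row_of_seq n s).
Proof. by move=> sn; rewrite dotE sn; apply: eq_bigr => i _; rewrite !mxE. Qed.

Lemma eq_sphere_integral (n : nat) (f g : 'rV[R]_n -> R) :
  iter_integral n (fun s => let x := row_of_seq n s in
    if enorm x <= 1 then f ((enorm x)^-1 *: x) else 0) =
  iter_integral n (fun s => let x := row_of_seq n s in
    if enorm x <= 1 then g ((enorm x)^-1 *: x) else 0) ->
  sphere_integral f = sphere_integral g.
Proof. by rewrite /sphere_integral => ->. Qed.

(** After radial projection the integrand depends on the integration variable only through its inner
    product with the pole and its squared norm. *)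
Lemma sphere_integral_zonal (n : nat) (phi : R -> R) (x y : 'rV[R]_n.+2) :
  measurable_fun setT phi -> (forall t, 0 <= phi t) ->
  on_sphere x -> on_sphere y ->
  sphere_integral (fun z => phi (dotp x z)) =
  sphere_integral (fun z => phi (dotp y z)).
Proof.
move=> mphi phi0 x1 y1; apply: eq_sphere_integral.
(* [powR] with exponent [-1] is the inverse on nonnegative reals and is known
   to be measurable. *)
pose F (z : R * R) : R :=
  if Num.sqrt z.2 <= 1 then phi (Num.sqrt z.2 `^ (-1) * z.1) else 0.
have msqrt : measurable_fun setT (fun z : R * R => Num.sqrt z.2).
  exact: (measurableT_comp (continuous_measurable_fun (@sqrt_continuous R))).
have mF : measurable_fun setT F.
  apply: measurable_fun_ifT => //.
    by apply: measurable_fun_ler => //; exact: measurable_cst.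
  apply: measurableT_comp => //; apply: measurable_funM => //.
  exact: (measurableT_comp (measurable_powR (-1))).
have F0 z : 0 <= F z by rewrite /F; case: ifP.
have FE (w : 'rV[R]_n.+2) :
    iter_integral n.+2 (fun s => let v := row_of_seq n.+2 s in
      if enorm v <= 1 then phi (dotp w ((enorm v)^-1 *: v)) else 0) =
    iter_integral n.+2 (fun s => F (dot (codom (w 0)) s, dot s s)).
  apply: eq_iter_integral => s sn.
  rewrite /F /= (dot_row_of_seq sn) dot_codom -/(enorm _).
  by rewrite powR_inv1 ?sqrtr_ge0// [dotp w (_ *: _)]dotpC dotpZl dotpC.
have codom1 (w : 'rV[R]_n.+2) :
    on_sphere w -> dot (codom (w 0)) (codom (w 0)) = 1.
  move=> <-; rewrite dot_codom; congr dotp.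
  by apply/rowP => i; rewrite mxE nth_codom_ord.
rewrite !FE; apply: iter_integral_zonal => //.
- by rewrite size_codom card_ord.
- by rewrite size_codom card_ord.
- exact: codom1.
- exact: codom1.
Qed.

Definition linear_form (n : nat) (x : 'rV[R]_n) : mpoly.mpoly n R :=
  \sum_(i < n) x 0 i *: mpoly.mpolyX R (mpoly.mnm1 i).

Lemma peval_linear_form (n : nat) (x z : 'rV[R]_n) :
  peval (linear_form x) z = dotp x z.
Proof.
rewrite /peval /linear_form raddf_sum; apply: eq_bigr => i _.
by rewrite /= mpoly.mevalZ mpoly.mevalXU.
Qed.

Lemma msize_linear_formX (n : nat) (x : 'rV[R]_n) (k : nat) :
  (mpoly.msize (linear_form x ^+ k) <= k.+1)%N.
Proof.
elim: k => [|k IH]; first by rewrite expr0 mpoly.msize1.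
have lin2 : (mpoly.msize (linear_form x) <= 2)%N.
  apply: (leq_trans (mpoly.msize_sum _ _ _)).
  apply/bigmax_leqP => i _; apply: (leq_trans (mpoly.msizeZ_le _ _)).
  by rewrite mpoly.msizeX mpoly.mdeg1.
rewrite exprS.
have [->|l0] := eqVneq (linear_form x) 0; first by rewrite mul0r mpoly.msize0.
have [->|p0] := eqVneq (linear_form x ^+ k) 0.
  by rewrite mulr0 mpoly.msize0.
rewrite mpoly.msizeM//.
by move: (leq_add lin2 IH); case: (_ + _)%N.
Qed.

(** The design property turns both sums into spherical integrals of zonal polynomials, which agree
    by rotation invariance. *)
Lemma design_moment_zonal (n t k : nat) (C : seq 'rV[R]_n.+2)
    (x y : 'rV[R]_n.+2) :
  spherical_design t C -> (k <= t)%N -> on_sphere x -> on_sphere y ->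
  \sum_(z <- C) dotp x z ^+ k = \sum_(z <- C) dotp y z ^+ k.
Proof.
move=> [[_ C2 _] design] kt x1 y1.
(* Adding 1 makes the integrand nonnegative on the unit ball, as Tonelli requires; the extra terms
   cancel at the end. *)
pose p (w : 'rV[R]_n.+2) : mpoly.mpoly n.+2 R := linear_form w ^+ k + 1.
have pE w z : peval (p w) z = dotp w z ^+ k + 1.
  by rewrite /peval mpoly.mevalD mpoly.meval1 rmorphXn /= -/(peval _ _)
    peval_linear_form.
have psize w : (mpoly.msize (p w) <= t.+1)%N.
  rewrite (leq_trans (mpoly.msizeD_le _ _))// mpoly.msize1 geq_max andbT.
  by rewrite (leq_trans (msize_linear_formX _ _)).
(* The absolute value extends nonnegativity to the whole line and changes nothing on the unit
   ball. *)
pose phi (u : R) : R := `|u ^+ k + 1|.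
have mphi : measurable_fun setT phi.
  apply: measurableT_comp; first exact: normr_measurable.
  apply: measurable_funD; last exact: measurable_cst.
  by apply: measurable_funX.
have SE w : on_sphere w ->
    sphere_integral (peval (p w)) = sphere_integral (fun z => phi (dotp w z)).
  move=> w1; apply: eq_sphere_integral; apply: eq_iter_integral => s sn /=.
  case: ifP => // _; set v := _ *: _; rewrite pE /phi ger0_norm//.
  have : `|dotp w v ^+ k| <= 1.
    rewrite normrX exprn_ile1// ler_norm_dotp ?w1//; exact: dotp_normalize.
  by rewrite ler_norml => /andP[+ _]; rewrite -subr_ge0 opprK.
have S := etrans (SE x x1) (etrans
  (sphere_integral_zonal mphi (fun=> normr_ge0 _) x1 y1) (esym (SE y y1))).
have C0 : (size C)%:R^-1 != 0 :> R.
  by rewrite invr_eq0 pnatr_eq0 -lt0n (leq_trans _ C2).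
have := etrans (esym (design _ (psize x))) (etrans S (design _ (psize y))).
move=> /(mulfI C0).
rewrite (eq_bigr _ (fun z _ => pE x z)) (eq_bigr _ (fun z _ => pE y z)).
by rewrite !big_split => /addIr.
Qed.

End SphericalMoments.

(** * Explicit moments of a spherical design *)

Lemma poly_eq0_horner (R : realType) (p : {poly R}) :
  (forall t, p.[t] = 0) -> p = 0.
Proof.
move=> p0.
apply: (@roots_geq_poly_eq0 _ _ [seq i%:R | i <- iota 0 (size p)]).
- by apply/allP => x _; rewrite rootE p0.
- by rewrite map_inj_uniq ?iota_uniq//; exact: mulrIn (oner_neq0 _).
- by rewrite size_map size_iota.
Qed.

Section DesignMoments.
Context {R : realType} (n t : nat) (C : seq 'rV[R]_n.+2).
Hypothesis design : spherical_design t C.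

Let moment (k : nat) (x : 'rV[R]_n.+2) : R := \sum_(z <- C) dotp x z ^+ k.

Let momentZ (k : nat) (c : R) (x : 'rV[R]_n.+2) :
  moment k (c *: x) = c ^+ k * moment k x.
Proof.
by rewrite /moment mulr_sumr; apply: eq_bigr => z _; rewrite dotpZl exprMn.
Qed.

(** Antipodal points have equal moments by zonality and opposite ones by oddness. *)
Lemma design_moment_odd (k : nat) (x : 'rV[R]_n.+2) :
  (k <= t)%N -> odd k -> on_sphere x -> \sum_(z <- C) dotp x z ^+ k = 0.
Proof.
move=> kt ok x1; rewrite -/(moment k x).
have : moment k x = moment k (-1 *: x).
  apply: (design_moment_zonal design) => //.
  by rewrite /on_sphere dotpZl dotpC dotpZl mulrA mulN1r opprK mul1r.
by rewrite momentZ -signr_odd ok expr1 mulN1r; lra.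
Qed.

Let dotp_delta (i : 'I_n.+2) (z : 'rV[R]_n.+2) : dotp (delta_mx 0 i) z = z 0 i.
Proof.
rewrite /dotp (bigD1 i)//= mxE !eqxx mul1r big1 ?addr0// => j /negbTE ji.
by rewrite mxE ji andbF mul0r.
Qed.

(* For [i != j] the polynomial identity
   [moment k (e_i + s e_j) = (1 + s^2)^(k/2) moment k e_i] is compared at the
   coefficient of [s^2]. *)
Lemma design_moment_mixed (m : nat) (x : 'rV[R]_n.+2) (i j : 'I_n.+2) :
  (m.*2.+2 <= t)%N -> on_sphere x -> i != j ->
  \sum_(z <- C) dotp x z ^+ m.*2.+2 =
  m.*2.+1%:R * \sum_(z <- C) z 0 i ^+ m.*2 * z 0 j ^+ 2.
Proof.
move=> mt x1 ij; rewrite -/(moment _ _); set c := moment _ _.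
pose p : {poly R} := \sum_(z <- C) ((z 0 i)%:P + (z 0 j) *: 'X) ^+ m.*2.+2
   - c *: (1 + 'X^2) ^+ m.+1.
have p0 : p = 0.
  apply: poly_eq0_horner => s.
  rewrite /p hornerD hornerN hornerZ horner_exp hornerD hornerXn hornerC.
  rewrite horner_sum.
  pose v : 'rV[R]_n.+2 := delta_mx 0 i + s *: delta_mx 0 j.
  have vE z : dotp v z = z 0 i + z 0 j * s.
    by rewrite dotpDl dotpZl !dotp_delta mulrC.
  have vv : dotp v v = 1 + s ^+ 2.
    rewrite vE !mxE !eqxx (negbTE ij) eq_sym (negbTE ij) /=.
    by rewrite mulr0 addr0 add0r mulr1 expr2.
  have vv0 : 0 < dotp v v by rewrite vv ltr_pwDl// sqr_ge0.
  have u1 : on_sphere ((Num.sqrt (dotp v v))^-1 *: v).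
    rewrite /on_sphere dotpZl dotpC dotpZl mulrA -expr2 exprVn.
    by rewrite sqr_sqrtr ?(ltW vv0)// mulVf// gt_eqF.
  (* The moment has the same value [c] at every unit vector, in particular at the normalization of
     [v]. *)
  have -> : c = moment m.*2.+2 ((Num.sqrt (dotp v v))^-1 *: v).
    exact: (design_moment_zonal design).
  rewrite momentZ -doubleS -mul2n exprM exprVn sqr_sqrtr ?(ltW vv0)//.
  rewrite -vv mulrAC -exprMn mulVf ?gt_eqF// expr1n mul1r.
  apply/eqP; rewrite subr_eq0; apply/eqP; apply: eq_bigr => z _.
  by rewrite horner_exp !hornerE vE.
(* At ['X^2], ['C(2m+2, 2)] times the mixed sum equals [(m+1) c]; cancelling [m+1] leaves the factor
   [2m+1]. *)
have := congr1 (fun q : {poly R} => q`_2) p0.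
rewrite /p coefB coefZ coef_sum coef0.
have -> : ((1 + 'X^2 : {poly R}) ^+ m.+1)`_2 = m.+1%:R.
  rewrite exprDn coef_sum (bigD1 (inord 1))//= big1 => [|k].
    rewrite inordK// expr1n mul1r expr1 coefMn coefXn bin1 addr0.
    by rewrite -mulr_natr mul1r.
  rewrite -val_eqE /= inordK// => k1.
  rewrite expr1n mul1r coefMn -exprM coefXn.
  have /negbTE -> : (2 != 2 * k)%N.
    by apply: contraNneq k1 => e; rewrite -(@eqn_pmul2l 2)// -e.
  by rewrite mul0rn.
under eq_bigr => z _.
  rewrite exprDn coef_sum (bigD1 (inord 2))//= big1 => [|k].
    rewrite inordK// -polyC_exp exprZn coefMn coefCM coefZ coefXn eqxx mulr1.
    rewrite addr0.
    over.
  rewrite -val_eqE /= inordK// => k1.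
  rewrite -polyC_exp exprZn coefMn coefCM coefZ coefXn eq_sym (negbTE k1).
  by rewrite !mulr0 mul0rn.
have -> : 'C(m.*2.+2, 2) = (m.+1 * m.*2.+1)%N.
  by rewrite bin2 -[(_ * _)%N]/(m.+1.*2 * m.*2.+1)%N -doubleMl doubleK.
rewrite subn2 /= sumrMnl => /eqP; rewrite subr_eq0 => /eqP.
set S := \sum_(_ <- _) _ => E.
have m0 : m.+1%:R != 0 :> R by rewrite pnatr_eq0.
by apply: (mulIf m0); rewrite -E -[in LHS]mulr_natl natrM; ring.
Qed.

(** Inserting [|z|^2 = 1] splits the moment of order [2m] over the coordinates: one term is the
    moment of order [2m+2], each of the other [n+1] terms is that moment divided by [2m+1]. *)
Lemma design_moment_even (m : nat) (x : 'rV[R]_n.+2) :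
  (m.*2.+2 <= t)%N -> on_sphere x ->
  (n.+2 + m.*2)%:R * \sum_(z <- C) dotp x z ^+ m.*2.+2 =
  m.*2.+1%:R * \sum_(z <- C) dotp x z ^+ m.*2.
Proof.
move=> mt x1.
have e1 : on_sphere (delta_mx 0 ord0 : 'rV[R]_n.+2).
  by rewrite /on_sphere dotp_delta mxE !eqxx.
have mt' : (m.*2 <= t)%N by do 2 apply: ltnW.
rewrite (design_moment_zonal design mt' x1 e1).
have -> : \sum_(z <- C) dotp (delta_mx 0 ord0) z ^+ m.*2 =
    \sum_(j < n.+2) \sum_(z <- C) z 0 ord0 ^+ m.*2 * z 0 j ^+ 2.
  rewrite exchange_big /=; apply: eq_big_seq => z zC.
  have [[_ _ /(_ z zC) z1] _] := design.
  rewrite -mulr_sumr dotp_delta -[LHS]mulr1; congr (_ * _).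
  by apply: etrans (esym z1) _; apply: eq_bigr => j _; rewrite expr2.
rewrite big_ord_recl mulrDr [X in _ = _ + X]mulr_sumr.
have -> : \sum_(z <- C) z 0 ord0 ^+ m.*2 * z 0 ord0 ^+ 2 = moment m.*2.+2 x.
  rewrite /moment (design_moment_zonal design mt x1 e1).
  by apply: eq_bigr => z _; rewrite dotp_delta -exprD addn2.
rewrite [X in _ = _ + X](eq_bigr (fun=> moment m.*2.+2 x)) => [|j _]; last first.
  by rewrite -(design_moment_mixed mt x1 (neq_lift ord0 j)).
rewrite sumr_const card_ord -[X in _ = _ + X]mulr_natl -mulrDl -natrD.
by congr (_%:R * _); rewrite addnC addSnnS.
Qed.

End DesignMoments.

(** * Hermite interpolation *)

Lemma derivn_top (R : nzRingType) (n : nat) (p : {poly R}) :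
  (size p <= n.+1)%N -> derivn n p = (p`_n *+ n`!)%:P.
Proof.
move=> pn; apply/polyP => i; rewrite coef_derivn coefC.
case: i => [|i]; first by rewrite addn0 ffactnn.
by rewrite nth_default ?mul0rn// (leq_trans pn)// addnS ltnS leq_addr.
Qed.

Section HermiteInterpolation.
Context {F : fieldType}.
Implicit Types (s d : seq F) (f g : F -> F).

Lemma horner_prod_XsubC_eq0 s x :
  ((\prod_(z <- s) ('X - z%:P)).[x] == 0) = (x \in s).
Proof. by rewrite -rootE root_prod_XsubC. Qed.

Lemma deriv_prod_XsubC_neq0 s x : uniq s -> x \in s ->
  (deriv (\prod_(z <- s) ('X - z%:P))).[x] != 0.
Proof.
move=> us xs; rewrite (big_rem x)//= derivM derivXsubC mul1r hornerD hornerM.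
rewrite hornerXsubC subrr mul0r addr0 horner_prod_XsubC_eq0.
by rewrite mem_rem_uniq// inE eqxx.
Qed.

Lemma lagrange_interpolation s f : uniq s ->
  exists2 p : {poly F}, (size p <= size s)%N & forall x, x \in s -> p.[x] = f x.
Proof.
elim: s => [|a s IH] /=; first by exists 0; rewrite ?size_poly0.
move=> /andP[as_ us]; have [p ps pf] := IH us.
pose W : {poly F} := \prod_(z <- s) ('X - z%:P).
exists (p + ((f a - p.[a]) / W.[a]) *: W) => [|x].
  rewrite (leq_trans (size_polyD _ _))// geq_max (leq_trans ps)//=.
  by rewrite (leq_trans (size_scale_leq _ _))// size_prod_XsubC.
rewrite inE hornerD hornerZ => /predU1P[->|xs].
  by rewrite divfK ?horner_prod_XsubC_eq0// addrC subrK.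
have /eqP -> : W.[x] == 0 by rewrite horner_prod_XsubC_eq0.
by rewrite mulr0 addr0 pf.
Qed.

(** Adding [W * r] keeps the values on [s] and changes the derivative at a node [x] by [W'(x) r(x)].
    As [W'(x)] is nonzero, a Lagrange interpolant [r] on [d] corrects the derivatives. *)
Lemma hermite_interpolation s d f g : uniq s -> uniq d -> {subset d <= s} ->
  exists p : {poly F}, [/\ (size p <= size s + size d)%N,
    forall x, x \in s -> p.[x] = f x & forall x, x \in d -> (deriv p).[x] = g x].
Proof.
move=> us ud ds; have [q qs qf] := lagrange_interpolation f us.
pose W : {poly F} := \prod_(z <- s) ('X - z%:P).
have [r rd rg] :=
  lagrange_interpolation (fun x => (g x - (deriv q).[x]) / (deriv W).[x]) ud.
have W0 x : x \in s -> W.[x] = 0.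
  by move=> xs; apply/eqP; rewrite horner_prod_XsubC_eq0.
exists (q + W * r); split => [|x xs|x xd].
- rewrite (leq_trans (size_polyD _ _))// geq_max.
  rewrite (leq_trans qs) ?leq_addr//=.
  rewrite (leq_trans (size_polyMleq _ _))// size_prod_XsubC /=.
  by rewrite leq_add2l.
- by rewrite hornerD hornerM W0// mul0r addr0 qf.
- have xs := ds _ xd; rewrite derivD derivM !(hornerD, hornerM) W0// mul0r addr0.
  by rewrite rg// mulrC divfK ?deriv_prod_XsubC_neq0// addrC subrK.
Qed.

End HermiteInterpolation.

(** * Zero counting by Rolle's theorem and the interpolation error *)

(** This is the counting half of Rolle's theorem: one point is chosen in each gap of the sorted
    list, and points of different gaps differ. *)
Lemma interleave (R : realDomainType) (Q : R -> Prop) (s : seq R) : uniq s ->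
  (forall u v, u \in s -> v \in s -> u < v ->
     exists c, [/\ u < c, c < v & Q c]) ->
  exists s', [/\ uniq s', size s' = (size s).-1 &
    forall z, z \in s' -> z \notin s /\ Q z].
Proof.
move=> us; have : sorted <%R (sort <=%R s) by rewrite sort_lt_sorted.
have memE := mem_sort <=%R s; rewrite -(size_sort <=%R s) => ss H.
suff [s' [us' ss' s'Q]] : exists s', [/\ uniq s',
    size s' = (size (sort <=%R s)).-1 &
    forall z, z \in s' -> z \notin sort <=%R s /\ Q z].
  by exists s'; split => // z /s'Q; rewrite memE.
have {}H u v : u \in sort <=%R s -> v \in sort <=%R s -> u < v ->
    exists c, [/\ u < c, c < v & Q c] by rewrite !memE; exact: H.
move: (sort _ _) ss H => {us memE s} [|x s]; first by exists [::].
move=> /= xs H.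
(* The bound [x < z] is carried along to separate the point of the first gap from all later ones. *)
suff [s' [us' ss' s'Q]] : exists s', [/\ uniq s', size s' = size s &
    forall z, z \in s' -> [/\ x < z, z \notin x :: s & Q z]].
  by exists s'; split => // z /s'Q[].
elim: s x xs H => [|y s IH] x /=; first by exists [::].
move=> /andP[xy ys] H.
have [|s' [us' ss' s'Q]] := IH y ys.
  by move=> u v us vs; apply: H; rewrite inE ?us ?vs orbT.
have [||c [xc cy Qc]] := H x y _ _ xy; rewrite ?inE ?eqxx ?orbT//.
have cs' : c \notin s'.
  by apply/negP => /s'Q[yc _ _]; have := lt_trans yc cy; rewrite ltxx.
exists (c :: s'); split; rewrite /= ?cs' ?ss'// => z.
rewrite inE => /predU1P[->|/s'Q[yz zs Qz]]; last first.
  split; [exact: lt_trans yz| |by []].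
  by rewrite inE negb_or zs andbT gt_eqF// (lt_trans xy).
split => //; rewrite !inE !negb_or gt_eqF// lt_eqF//=.
apply/negP => cs; have := order_path_min lt_trans ys.
by move=> /allP/(_ _ cs) yc; have := lt_trans yc cy; rewrite ltxx.
Qed.

Section HermiteError.
Context {R : realType} (h : R -> R) (n : nat).
Hypothesis h_cont : {within `[(-1 : R), 1], continuous h}.
Hypothesis h_drv : forall k, (k < n)%N ->
  forall x : R, x \in `]-1, 1[%R -> derivable (derive1n k h) x 1.
Variable p : {poly R}.

Let D (k : nat) (x : R) : R := derive1n k h x - (derivn k p).[x].

Let is_derive_D (k : nat) (x : R) : (k < n)%N -> x \in `]-1, 1[%R ->
  is_derive x 1 (D k) (D k.+1 x).
Proof.
move=> kn x1; have /derivableP := h_drv kn x1.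
rewrite -derive1E => dh; rewrite /D derive1nS derivnS.
exact: is_deriveB.
Qed.

(** Continuity is a separate premise because for [k = 0] the interval may reach [-1] or [1], where
    [h] is only known to be continuous. *)
Let Rolle_D (k : nat) (u v : R) : (k < n)%N -> u \in `[-1, 1]%R ->
  v \in `[-1, 1]%R -> u < v -> {within `[u, v], continuous (D k)} ->
  D k u = 0 -> D k v = 0 ->
  exists c, [/\ u < c, c < v & (c \in `]-1, 1[%R) /\ D k.+1 c = 0].
Proof.
move=> kn u1 v1 uv cD Du Dv.
have sub x : x \in `]u, v[%R -> x \in `]-1, 1[%R.
  rewrite !in_itv /= => /andP[ux xv]; move: u1 v1.
  rewrite !in_itv /= => /andP[u1 _] /andP[_ v1].
  by rewrite (le_lt_trans u1) ?(lt_le_trans xv).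
have [||c cuv dc] := Rolle uv _ cD.
- by move=> x /sub x1; have [] := is_derive_D kn x1.
- by rewrite Du Dv.
exists c; have c1 := sub _ cuv; move: cuv; rewrite in_itv /= => /andP[-> ->].
split => //; split => //.
by have [_ <-] := is_derive_D kn c1; have [_ ->] := dc.
Qed.

Let iterated_Rolle (m k : nat) (s : seq R) : (k + m <= n)%N -> uniq s ->
  size s = m.+1 -> (forall x, x \in s -> (x \in `]-1, 1[%R) /\ D k x = 0) ->
  exists2 x : R, x \in `]-1, 1[%R & D (k + m) x = 0.
Proof.
elim: m k s => [|m IH] k s.
  case: s => [|x s] // _ _ _ /(_ x); rewrite mem_head => -[]// x1 Dx.
  by exists x; rewrite ?addn0.
rewrite addnS => kmn us sm sD.
have kn : (k < n)%N by rewrite (leq_trans _ kmn)// ltnS leq_addr.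
have [|s' [us' ss' s'D]] := interleave
  (Q := fun c => (c \in `]-1, 1[%R) /\ D k.+1 c = 0) us.
  move=> u v /sD[u1 Du] /sD[v1 Dv] uv.
  apply: Rolle_D => //; rewrite ?(subset_itv_oo_cc u1) ?(subset_itv_oo_cc v1)//.
  apply: derivable_within_continuous => x /itvP xuv.
  have x1 : x \in `]-1, 1[%R.
    move: u1 v1; rewrite !in_itv /= => /andP[u1 _] /andP[_ v1].
    by rewrite (lt_le_trans u1) ?(le_lt_trans _ v1) ?xuv.
  by have [] := is_derive_D kn x1.
rewrite -addSn; apply: (IH k.+1 s') => //; first by rewrite ss' sm.
by move=> x /s'D[].
Qed.

(** A first use of Rolle gives [size s - 1] zeros of the derivative of [h - p] off [s]. With those
    on [d] there are [n], and [n - 1] further uses leave a zero of the [n]-th derivative. *)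
Lemma hermite_mean_value (s d : seq R) :
  uniq s -> uniq d -> {subset d <= s} ->
  size s + size d = n.+1 -> (0 < n)%N -> (0 < size s)%N ->
  (forall x, x \in s -> (x \in `[-1, 1]%R) /\ h x = p.[x]) ->
  (forall x, x \in d -> (x \in `]-1, 1[%R) /\ derive1 h x = (deriv p).[x]) ->
  exists2 x : R, x \in `]-1, 1[%R & derive1n n h x = (derivn n p).[x].
Proof.
move=> us ud ds sdn n0 s0 sP dP.
have [|s' [us' ss' s'D]] := interleave
  (Q := fun c => (c \in `]-1, 1[%R) /\ D 1 c = 0) us.
  move=> u v /sP[u1 hu] /sP[v1 hv] uv.
  apply: Rolle_D => //; rewrite /D ?derive1n0 ?derivn0 ?hu ?hv ?subrr//.
  have sub : `[u, v]%classic `<=` `[-1, 1]%classic.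
    apply: subset_itv; rewrite ?bnd_simp.
      by move: u1; rewrite in_itv => /andP[].
    by move: v1; rewrite in_itv => /andP[].
  have cu := continuous_subspaceW sub h_cont.
  move=> x; apply: continuousB; first exact: cu.
  by apply: continuous_subspaceT => y; exact: continuous_horner.
have [||||x x1 Dx] := @iterated_Rolle n.-1 1%N (s' ++ d).
- by rewrite add1n prednK.
- rewrite cat_uniq us' ud andbT /=; apply/hasPn => x xd.
  by apply/negP => /(s'D x)[/negP xs _]; exact/xs/ds.
- rewrite size_cat ss' prednK//.
  by apply: succn_inj; rewrite -addSn prednK.
- move=> x; rewrite mem_cat => /orP[/s'D[]//|/dP[x1 hx]].
  by split => //; rewrite /D derivn1 derive1n1 hx subrr.
exists x => //; apply/eqP; rewrite -subr_eq0; apply/eqP.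
by move: Dx; rewrite add1n prednK.
Qed.

End HermiteError.

(* Rolle's theorem applied to h - p - K w, with w the nodal polynomial and K
   chosen to make t an additional zero, identifies K with h^(n)(x) / n!. *)
Lemma hermite_majorant (R : realType) (h : R -> R) (n : nat) (s d : seq R)
    (p : {poly R}) (t : R) :
  {within `[(-1 : R), 1], continuous h} ->
  (forall k, (k < n)%N ->
     forall x : R, x \in `]-1, 1[%R -> derivable (derive1n k h) x 1) ->
  (forall x : R, x \in `]-1, 1[%R -> 0 <= derive1n n h x) ->
  uniq s -> uniq d -> {subset d <= s} -> size s + size d = n -> (0 < n)%N ->
  (forall x, x \in s -> x \in `[-1, 1]%R) ->
  (forall x, x \in d -> x \in `]-1, 1[%R) ->
  (size p <= n)%N ->
  (forall x, x \in s -> p.[x] = h x) ->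
  (forall x, x \in d -> (deriv p).[x] = derive1 h x) ->
  t \in `[-1, 1]%R ->
  \prod_(z <- s) (t - z) * \prod_(z <- d) (t - z) <= 0 ->
  h t <= p.[t].
Proof.
move=> h_cont h_drv hn us ud ds sdn n0 s1 d1 pn ps pd t1 wt.
have [ts|ts] := boolP (t \in s); first by rewrite ps.
pose W (r : seq R) : {poly R} := \prod_(z <- r) ('X - z%:P).
pose w := W s * W d.
have wE : w.[t] = \prod_(z <- s) (t - z) * \prod_(z <- d) (t - z).
  rewrite hornerM !horner_prod.
  by congr (_ * _); apply: eq_bigr => z _; rewrite hornerXsubC.
have W0 r x : ((W r).[x] == 0) = (x \in r) by rewrite horner_prod_XsubC_eq0.
have wt0 : w.[t] != 0.
  rewrite hornerM mulf_eq0 !W0 negb_or ts /=.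
  by apply: contra ts => /ds.
have ws x : x \in s -> w.[x] = 0.
  by rewrite hornerM -W0 => /eqP ->; rewrite mul0r.
have wd x : x \in d -> (deriv w).[x] = 0.
  move=> xd; rewrite derivM hornerD !hornerM.
  have /eqP -> : (W s).[x] == 0 by rewrite W0 ds.
  have /eqP -> : (W d).[x] == 0 by rewrite W0.
  by rewrite mulr0 mul0r addr0.
have wsize : size w = n.+1.
  rewrite size_Mmonic ?monic_prod_XsubC ?monic_neq0 ?monic_prod_XsubC//.
  by rewrite !size_prod_XsubC addSn addnS; congr _.+1.
have wmon : w \is monic by rewrite monicMr ?monic_prod_XsubC.
have wn : w`_n = 1.
  by move/monicP: wmon; rewrite /lead_coef wsize.
pose K := (h t - p.[t]) / w.[t].
have [||||||||x x1 hx] :=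
  @hermite_mean_value R h n h_cont h_drv (p + K *: w) (t :: s) d.
- by rewrite /= ts.
- by [].
- by move=> z /ds zs; rewrite inE zs orbT.
- exact: (congr1 succn sdn).
- by [].
- by [].
- move=> x; rewrite inE => /predU1P[->|xs]; split => //.
  + by rewrite hornerD hornerZ divfK// addrC subrK.
  + exact: s1.
  + by rewrite hornerD hornerZ ws// mulr0 addr0 ps.
- move=> x xd; split; first exact: d1.
  by rewrite derivD derivZ hornerD hornerZ wd// mulr0 addr0 pd.
(* As [p] has degree below [n] and [w] is monic of degree [n], the [n]-th derivative of [p + K *: w]
   is the constant [n! K]. *)
have K0 : 0 <= K.
  have := hn x x1; rewrite hx derivn_top; last first.
    rewrite (leq_trans (size_polyD _ _))// geq_max (leq_trans pn) ?leqnSn//=.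
    by rewrite (leq_trans (size_scale_leq _ _))// wsize.
  rewrite hornerC coefD coefZ wn mulr1 nth_default// add0r.
  by rewrite pmulrn_lge0// fact_gt0.
rewrite -subr_le0 -[leLHS](divfK wt0) -/K wE.
by rewrite mulr_ge0_le0.
Qed.

(** * The P48 quadrature rule and the energy bound *)

(* Numerals in nat are unary, and reducing one of this size exhausts memory:
   the weights stay opaque variables until the final linear arithmetic. *)
Lemma energy_P48_weights (R : realType) : exists a b c d : R,
  [/\ a = 36848%:R, b = 1678887%:R, c = 12608784%:R, d = 23766960%:R &
  forall h : R -> R, energy_P48 h = a * (h (- (1/2)) + h (1/2))
    + b * (h (- (1/3)) + h (1/3)) + c * (h (- (1/6)) + h (1/6))
    + d * h 0 + h (-1)].
Proof.
exists 36848%:R, 1678887%:R, 12608784%:R, 23766960%:R.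
exact: And5 erefl erefl erefl erefl (fun=> erefl).
Qed.

(** The recurrence determines every even moment from [S 0]. The leading [1] on the right is the node
    1 with weight 1: the inner product of a code point with itself. *)
Lemma P48_quadrature (R : realFieldType) (S : nat -> R) (a b c d : R) :
  (forall k, (k <= 11)%N -> odd k -> S k = 0) ->
  (forall m, (m.*2.+2 <= 11)%N ->
     (48 + m.*2)%:R * S m.*2.+2 = m.*2.+1%:R * S m.*2) ->
  forall k, (k < 12)%N -> S 0%N = 52416000%:R ->
  a = 36848%:R -> b = 1678887%:R -> c = 12608784%:R -> d = 23766960%:R ->
  S k = 1 + (a * ((- (1/2)) ^+ k + (1/2) ^+ k)
    + b * ((- (1/3)) ^+ k + (1/3) ^+ k)
    + c * ((- (1/6)) ^+ k + (1/6) ^+ k) + d * 0 ^+ k + (-1) ^+ k).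
Proof.
move=> So Se.
have S2 : 48%:R * S 2 = S 0%N by rewrite -[RHS]mul1r -(Se 0%N).
have S4 : 50%:R * S 4 = 3%:R * S 2 by rewrite -(Se 1%N).
have S6 : 52%:R * S 6 = 5%:R * S 4 by rewrite -(Se 2%N).
have S8 : 54%:R * S 8 = 7%:R * S 6 by rewrite -(Se 3%N).
have S10 : 56%:R * S 10 = 9%:R * S 8 by rewrite -(Se 4%N).
have := (So 1%N isT isT, So 3%N isT isT, So 5%N isT isT, So 7%N isT isT,
         So 9%N isT isT, So 11%N isT isT).
move=> [[[[[S1 S3] S5] S7] S9] S11] {So Se}.
move=> [|[|[|[|[|[|[|[|[|[|[|[|k]]]]]]]]]]]] lt_k; last first.
  by exfalso; move: lt_k; clear.
all: move=> {lt_k} S0 Ea Eb Ec Ed.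
all: lra.
Qed.

Lemma design_sum_horner (R : realType) (C : seq 'rV[R]_48) (p : {poly R}) :
  spherical_design 11 C -> (size p <= 12)%N -> size C = 52416000%N ->
  forall x, on_sphere x ->
  \sum_(z <- C) p.[dotp x z] = p.[1] + energy_P48 (horner p).
Proof.
move=> design p12 sC x x1; move: sC.
have pE t : p.[t] = \sum_(k < 12) p`_k * t ^+ k by exact: horner_coef_wide.
pose S (k : nat) : R := \sum_(z <- C) dotp x z ^+ k.
have S0 : S 0%N = (size C)%:R.
  by rewrite /S big_const_seq count_predT iter_addr_0.
have So k : (k <= 11)%N -> odd k -> S k = 0.
  by move=> k11 ok; exact: (design_moment_odd design k11 ok x1).
have Se m : (m.*2.+2 <= 11)%N ->
    (48 + m.*2)%:R * S m.*2.+2 = m.*2.+1%:R * S m.*2.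
  by move=> m11; exact: (design_moment_even design m11 x1).
have [a [b [c [d [Ea Eb Ec Ed ->]]]]] := energy_P48_weights R.
have SE k k12 := @P48_quadrature R S a b c d So Se k k12.
move=> sC; rewrite sC in S0.
have {}SE (k : 'I_12) := SE k (ltn_ord k) S0 Ea Eb Ec Ed.
move=> {sC S0 Ea Eb Ec Ed}.
rewrite (eq_bigr _ (fun z _ => pE (dotp x z))) exchange_big /=.
rewrite !pE -!big_split /= !mulr_sumr -!big_split /=.
apply: eq_bigr => k _; rewrite -mulr_sumr -/(S k) SE.
by rewrite expr1n; ring.
Qed.

Theorem theorem4p6 (R : realType) (h : R -> R) :
  {within `[(-1 : R), 1], continuous h} ->
  (forall k : nat, (k < 12)%N ->
     forall x : R, x \in `]-1, 1[ -> derivable (h^`(k)) x 1) ->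
  (forall x : R, x \in `]-1, 1[ -> 0 <= h^`(12) x) ->
  forall C : seq 'rV[R]_48,
    spherical_design 11 C -> avoiding (@T1 R) C -> size C = 52416000%N ->
    energy h C <= energy_P48 h.
Proof.
move=> h_cont h_drv h12 C design av.
have [[uC C2 C1] _] := design.
(* The nodes [-1], [1], [-1/3], [1/3], [-1/6], [1/6] bound the three admissible intervals and are
   simple. Those in [d] are interior, so they are doubled to avoid a sign change; the count is 9 + 3
   = 12. *)
pose s : seq R :=
  [:: -1; - (1/2); - (1/3); - (1/6); 0; 1/6; 1/3; 1/2; 1].
pose d : seq R := [:: - (1/2); 0; 1/2].
have us : uniq s.
  apply: (sorted_uniq lt_trans ltxx); rewrite /s /=.
  by repeat (apply/andP; split => //); lra.
have ud : uniq d.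
  apply: (sorted_uniq lt_trans ltxx); rewrite /d /=.
  by repeat (apply/andP; split => //); lra.
have ds : {subset d <= s}.
  by move=> x; rewrite /s /d !inE => /or3P[] /eqP ->; rewrite eqxx ?orbT.
have s1 x : x \in s -> x \in `[-1, 1]%R.
  rewrite in_itv /s /= => xs; apply/andP; move: xs; rewrite !inE.
  by do ?case/orP; move=> /eqP ->; split; lra.
have d1 x : x \in d -> x \in `]-1, 1[%R.
  rewrite in_itv /d /= => xd; apply/andP; move: xd; rewrite !inE.
  by do ?case/orP; move=> /eqP ->; split; lra.
have [p [p12 ps pd]] := hermite_interpolation h (derive1 h) us ud ds.
have hp t : t \in `[-1, 1]%R -> ~ T1 t -> h t <= p.[t].
  move=> t1 tT.
  apply: (@hermite_majorant R h 12 s d p t) => //.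
  - by move=> k k12 x x1; apply: h_drv => //; rewrite inE.
  - by move=> x x1; apply: h12; rewrite inE.
  rewrite /s /d !big_cons !big_nil.
  set w := (X in X <= 0).
  (* The doubled nodes form the square and [t ^+ 2 - 1] is nonpositive; the middle product is
     negative exactly when [1/6 < |t| < 1/3], that is, on [T1]. *)
  have -> : w = (t ^+ 2 - 1) * ((t ^+ 2 - (1/3) ^+ 2) * (t ^+ 2 - (1/6) ^+ 2))
      * ((t ^+ 2 - (1/2) ^+ 2) * t) ^+ 2 by rewrite /w; field.
  move: t1; rewrite in_itv /= => /andP[tl tr].
  have t2 : t ^+ 2 - 1 <= 0 by nra.
  apply: mulr_le0_ge0; last exact: sqr_ge0.
  apply: mulr_le0_ge0 => //.
  have [ta|ta] := lerP (- (1/6)) t; have [tb|tb] := lerP t (1/6).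
  - by apply: mulr_le0; nra.
  - have tc : 1/3 <= t.
      by rewrite leNgt; apply/negP => tc; apply: tT; right; rewrite tb.
    by apply: mulr_ge0; nra.
  - have tc : t <= - (1/3).
      by rewrite leNgt; apply/negP => tc; apply: tT; left; rewrite tc.
    by apply: mulr_ge0; nra.
  - by lra.
(* Every node of [energy_P48] lies in [s], where [p] agrees with [h]. *)
have Ep : energy_P48 (horner p) = energy_P48 h.
  by rewrite /energy_P48 !ps // /s !inE !eqxx ?orbT.
have rowE : size C = 52416000%N ->
    forall x, x \in C -> \sum_(y <- C | y != x) h (dotp x y) <= energy_P48 h.
  move=> /(design_sum_horner design p12) sumE x xC; have x1 := C1 x xC.
  have := sumE x x1.
  (* The diagonal term [y = x] contributes [p.[1]] and cancels the node 1 of the quadrature. *)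
  rewrite (bigD1_seq x)//= x1 Ep => /addrI <-.
  rewrite big_seq_cond [leRHS]big_seq_cond; apply: ler_sum => y /andP[yC yx].
  apply: hp.
    rewrite in_itv /= -ler_norml; apply: ler_norm_dotp.
      by rewrite x1.
    by rewrite (C1 y yC).
  by apply: av => //; rewrite eq_sym.
move=> /rowE {}rowE.
have C0 : 0 < (size C)%:R :> R by rewrite ltr0n (leq_trans _ C2).
rewrite /energy mulrC ler_pdivrMr//.
apply: (@le_trans _ _ (\sum_(x <- C) energy_P48 h)).
  by rewrite big_seq [leRHS]big_seq; apply: ler_sum.
by rewrite big_const_seq count_predT iter_addr_0 mulr_natr.
Qed.
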